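(* For $n\in\mathbb{N}$, $\mathcal{C}_n = (1-\log 2)n+O\left(\sqrt{n}\right)$, and hence $\lim_{n\to\infty}\frac{1}{n}\mathcal{C}_n=1-\log 2$.
   Context: $\mathbb{N}$ denotes the set of positive integers, $\lceil\cdot\rceil$ the ceiling function, and $\log$ the natural logarithm. For $n\in\mathbb{N}$, $\mathcal{C}_n = \#\{k\in\mathbb{Z} : 1\le k\le n,\ \lceil n/k\rceil\text{ is odd}\}$. Big O notation: $f(n)=O(g(n))$ means there exist constants $M$ and $a$ such that $|f(n)|\le M g(n)$ for all $n\ge a$. *)

(* Defs.v *)
From mathcomp Require Import all_boot all_order all_algebra.
From mathcomp Require Import all_classical all_reals all_analysis.
Set Implicit Arguments. Unset Strict Implicit. Unset Printing Implicit Defensive.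
Import Order.TTheory GRing.Theory Num.Theory.
Local Open Scope ring_scope.

(* For k >= 1 the ceiling is nonnegative, so that its absolute value, to which
   the parity test on nat is applied, is the ceiling itself.                  *)
Definition odd_ceil_count (n : nat) : nat :=
  #|[set k : 'I_n.+1 |
      (1 <= k <= n)%N && odd `|Num.ceil (n%:R / k%:R : rat)|%N]|.

(* Main.v *)
Require Import Defs.
From mathcomp Require Import all_boot all_order all_algebra.
From mathcomp Require Import all_classical all_reals all_analysis.
From mathcomp Require Import zify ring lra.
Import Order.TTheory GRing.Theory Num.Theory.
Import numFieldNormedType.Exports.
Local Open Scope classical_set_scope.
Local Open Scope ring_scope.

(* As ceil(n/k) = floor((n-1)/k) + 1, the complement of C_n counts the k < n
   with floor(m/k) odd, where m = n - 1. Since the parity of q is the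
   alternating sum of (-1)^j over j < q, truncating at j < J changes only the
   terms with floor(m/k) > J, of which there are floor(m/(J+1)), and exchanging
   the sums leaves \sum_(j < J) (-1)^j floor(m/(j+1)). Dropping the floors costs J,
   and the partial sum of the alternating harmonic series is ln 2 + O(1/J).
   The choice of J of order sqrt n balances the errors. *)

Lemma ceil_divSS (F : archiRealFieldType) (m k : nat) :
  Num.ceil (m.+1%:R / k.+1%:R : F) = (m %/ k.+1).+1%:Z.
Proof.
apply: ceil_def; have k0 : 0 < k.+1%:R :> F by rewrite ltr0n.
have -> : (m %/ k.+1).+1%:Z - 1 = (m %/ k.+1)%:Z by lia.
rewrite -!pmulrn ltr_pdivlMr // ler_pdivrMr // -!natrM ltr_nat ler_nat.
by rewrite ltnS leq_trunc_div ltn_ceil.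
Qed.

Lemma odd_ceil_countS (m : nat) :
  (odd_ceil_count m.+1 + \sum_(k < m) odd (m %/ k.+1) = m.+1)%N.
Proof.
rewrite /odd_ceil_count cardsE -sum1_card big_mkcond /= big_ord_recl /=.
rewrite [X in (X + _ + _)%N]/= add0n.
under eq_bigr => k _ do rewrite unfold_in /= ceil_divSS /= ltn_ord /=.
(* The added index [k = m] contributes [m %/ m.+1 = 0]. Both sums now run over the same [m.+1]
   indices, and each index is counted by exactly one of them. *)
have -> : (\sum_(k < m) odd (m %/ k.+1) = \sum_(k < m.+1) odd (m %/ k.+1))%N.
  by rewrite big_ord_recr /= divn_small // addn0.
rewrite -big_split /= -[RHS]card_ord -sum1_card.
by apply: eq_bigr => k _; case: odd.
Qed.

Lemma sum_ltn_minn (M a : nat) : (\sum_(k < M) (k < a) = minn M a)%N.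
Proof.
elim: M => [|M IH]; first by rewrite big_ord0 min0n.
by rewrite big_ord_recr /= IH; lia.
Qed.

(** The condition [j < m %/ k.+1] means [j.+1 * k.+1 <= m], which is symmetric in [j] and [k]; so it
    amounts to [k < m %/ j.+1]. *)
Lemma divn_sum_ltn (m j : nat) :
  (m %/ j.+1 = \sum_(k < m) (j < m %/ k.+1))%N.
Proof.
under eq_bigr => k _ do rewrite leq_divRL // mulnC -leq_divRL //.
by rewrite sum_ltn_minn (minn_idPr _) // leq_div.
Qed.

Lemma odd_minn_sum (R : pzRingType) (J q : nat) :
  (odd (minn J q))%:R = \sum_(j < J) (-1) ^+ j * (j < q)%:R :> R.
Proof.
elim: J => [|J IH]; first by rewrite big_ord0 min0n.
rewrite big_ord_recr /= -IH; case: (ltnP J q) => [Jq|qJ].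
  rewrite (minn_idPl Jq) -signr_odd mulr1 oddS.
  by case: (odd J); rewrite ?expr1 ?expr0 ?subrr ?add0r.
by rewrite (minn_idPr (leqW qJ)) mulr0 addr0.
Qed.

Lemma odd_divn_sum_approx (R : realDomainType) (m J : nat) :
  `| (\sum_(k < m) odd (m %/ k.+1))%:R
     - \sum_(j < J) (-1) ^+ j * (m %/ j.+1)%:R : R | <= (m %/ J.+1)%:R.
Proof.
have -> : \sum_(j < J) (-1) ^+ j * (m %/ j.+1)%:R
    = \sum_(k < m) (odd (minn J (m %/ k.+1)))%:R :> R.
  under [RHS]eq_bigr => k _ do rewrite odd_minn_sum.
  rewrite exchange_big /=; apply: eq_bigr => j _.
  by rewrite divn_sum_ltn natr_sum mulr_sumr.
(* The bound is itself a count of the [k] with [J < m %/ k.+1], the only ones at which truncation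
   can alter the parity, so the comparison is termwise. *)
rewrite natr_sum -sumrB (divn_sum_ltn m J) natr_sum.
apply: le_trans (ler_norm_sum _ _ _) _; apply: ler_sum => k _.
case: ltnP => [Jq|qJ]; last by rewrite subrr normr0.
by do 2![case: odd]; rewrite ?subrr ?sub0r ?subr0 ?normrN ?normr1 ?normr0.
Qed.

Lemma alt_sum_drop_floor (R : realFieldType) (m J : nat) :
  `| \sum_(j < J) (-1) ^+ j * (m %/ j.+1)%:R
     - m%:R * \sum_(j < J) (-1) ^+ j / j.+1%:R : R | <= J%:R.
Proof.
rewrite mulr_sumr -sumrB -[J in leRHS]card_ord -sum1_card natr_sum.
apply: le_trans (ler_norm_sum _ _ _) _; apply: ler_sum => j _.
rewrite mulrCA -mulrBr normrM normrX normrN1 expr1n mul1r.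
have j0 : 0 < j.+1%:R :> R by rewrite ltr0n.
rewrite ler_norml lerBrDl lerBlDl; apply/andP; split.
  rewrite ler_pdivrMr // -natrD -natrM ler_nat add1n.
  by rewrite ltnW // ltn_ceil.
rewrite lerBlDr; apply: (@le_trans _ _ (m%:R / j.+1%:R)); last by rewrite lerDr.
by rewrite ler_pdivlMr // -natrM ler_nat leq_trunc_div.
Qed.

(** Catalan's identity: flipping the signs of the even denominators in the harmonic sum H_2N
    subtracts 2 (1/2 + 1/4 + ... + 1/(2N)) = H_N. *)
Lemma alt_harmonic_double (F : numFieldType) (N : nat) :
  \sum_(j < N.*2) (-1) ^+ j / j.+1%:R = \sum_(k < N) (N + k).+1%:R^-1 :> F.
Proof.
pose h j : F := j.+1%:R^-1.
(* Adding H_N to both sides fixes the starting point of the right-hand sum, which otherwise moves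
   with [N] and blocks the induction. *)
suff E : \sum_(j < N.*2) (-1) ^+ j / j.+1%:R + \sum_(j < N) h j
    = \sum_(j < N + N) h j
  by apply: (addIr (\sum_(j < N) h j)); rewrite E big_split_ord addrC.
rewrite addnn; elim: N => [|N IH]; first by rewrite !big_ord0 addr0.
rewrite doubleS !big_ord_recr /= -IH exprS -[(-1) ^+ N.*2]signr_odd.
rewrite odd_double expr0 /h.
have -> : N.+1%:R^-1 = 2 * N.*2.+2%:R^-1 :> F.
  by rewrite -doubleS -mul2n natrM invfM mulrA mulfV ?pnatr_eq0 // mul1r.
ring.
Qed.

(** This is ln (1 + t) <= t at t = (y - x) / x. Taking [x] as the larger or the smaller of two
    consecutive integers bounds the increment of ln from below or from above. *)
Lemma ln_sub_le (R : realType) (x y : R) : 0 < x -> 0 < y ->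
  ln y - ln x <= (y - x) / x.
Proof.
move=> x0 y0; rewrite -ln_div //.
have -> : y / x = 1 + (y - x) / x by field; lra.
by apply: le_ln1Dx; rewrite ltr_pdivlMr //; lra.
Qed.

Lemma harmonic_le_ln (R : realType) (N M : nat) : (0 < N)%N ->
  \sum_(k < M) (N + k).+1%:R^-1 <= ln (N + M)%:R - ln N%:R :> R.
Proof.
move=> N0; elim: M => [|M IH]; first by rewrite big_ord0 addn0 subrr.
have p : 0 < (N + M)%:R :> R by rewrite ltr0n; lia.
have q : 0 < (N + M).+1%:R :> R by rewrite ltr0n.
have := ln_sub_le _ _ _ q p.
have -> : ((N + M)%:R - (N + M).+1%:R) / (N + M).+1%:R = - (N + M).+1%:R^-1 :> R.
  by rewrite -[in X in X / _]natr1 opprD addrA subrr sub0r mulN1r.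
rewrite big_ord_recr /= addnS.
by move: IH; move: (_^-1) (ln _.+1%:R) (\sum_(_ < _) _) => *; lra.
Qed.

Lemma ln_le_harmonic (R : realType) (N M : nat) :
  ln (N + M).+1%:R - ln N.+1%:R <= \sum_(k < M) (N + k).+1%:R^-1 :> R.
Proof.
elim: M => [|M IH]; first by rewrite big_ord0 addn0 subrr.
have p : 0 < (N + M).+1%:R :> R by rewrite ltr0n.
have q : 0 < (N + M).+2%:R :> R by rewrite ltr0n.
have := ln_sub_le _ _ _ p q.
have -> : (N + M).+2%:R - (N + M).+1%:R = 1 :> R.
  by rewrite -[X in X - _]natr1 addrC addKr.
rewrite div1r big_ord_recr /= addnS.
move: IH; move: (_^-1) (ln _.+2%:R) (ln (N + M).+1%:R) (\sum_(_ < _) _) => *.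
lra.
Qed.

Lemma alt_harmonic_approx_ln2 (R : realType) (N : nat) : (0 < N)%N ->
  0 <= ln (2 : R) - \sum_(j < N.*2) (-1) ^+ j / j.+1%:R <= N.*2.+1%:R^-1.
Proof.
move=> N0; rewrite alt_harmonic_double.
have := harmonic_le_ln R N N N0; have := ln_le_harmonic R N N.
have N0R : 0 < N%:R :> R by rewrite ltr0n.
have -> : ln (N + N)%:R = ln 2 + ln N%:R :> R.
  by rewrite addnn -mul2n natrM lnM ?posrE ?ltr0n.
have p : 0 < (N + N).+1%:R :> R by rewrite ltr0n.
have q : 0 < (N + N).+2%:R :> R by rewrite ltr0n.
(* The lower bound ln (2N+1) - ln (N+1) falls short of ln 2 by ln (2N+2) - ln (2N+1), which is at
   most 1/(2N+1). *)
have := ln_sub_le _ _ _ p q.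
have -> : (N + N).+2%:R - (N + N).+1%:R = 1 :> R.
  by rewrite -[X in X - _]natr1 addrC addKr.
have -> : ln (N + N).+2%:R = ln 2 + ln N.+1%:R :> R.
  by rewrite addnn -doubleS -mul2n natrM lnM ?posrE ?ltr0n.
rewrite div1r -addnn.
by move: (_^-1) (ln (_ + _).+1%:R) (ln N.+1%:R) (\sum_(_ < _) _) => *; lra.
Qed.

(** For n = m + 1 and s = sqrt n, the constant 5 collects s from truncating, 2s from dropping the
    floors, s from approximating ln 2, and ln 2 <= 1 <= s from replacing n by m. *)
Lemma odd_ceil_count_bound (R : realType) (n : nat) :
  `| (odd_ceil_count n)%:R - (1 - ln 2) * n%:R : R | <= 5 * Num.sqrt n%:R.
Proof.
case: n => [|m].
  rewrite mulr0 subr0 /odd_ceil_count cardsE eq_card0.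
    by rewrite normr0 mulr_ge0 ?sqrtr_ge0.
  by move=> k; rewrite unfold_in; case: k => [[|k]].
set s := Num.sqrt _.
have s2 : s * s = m.+1%:R by rewrite -expr2 sqr_sqrtr.
have s0 : 0 <= s by rewrite sqrtr_ge0.
have s1 : 1 <= s by rewrite -sqrtr1 ler_wsqrtr // ler1n.
(* The truncation point is J = 2N, even as [alt_harmonic_approx_ln2] demands. Since m <= s^2 and s <
   N + 1 <= 2N + 1, the quotient m / (2N+1) is at most s, which controls two of the errors. *)
pose N := Num.truncn s.
have /andP[Ns sN] : N%:R <= s < N.+1%:R by apply: truncn_itv.
have N0 : (0 < N)%N by rewrite truncn_gt0.
have ms : m%:R / N.*2.+1%:R <= s.
  rewrite ler_pdivrMr ?ltr0n //; apply: (@le_trans _ _ (s * s)).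
    by rewrite s2 ler_nat.
  rewrite ler_wpM2l //; apply: le_trans (ltW sN) _.
  by rewrite ler_nat -addnn; lia.
have N2 : N.*2%:R = N%:R + N%:R :> R by rewrite -addnn natrD.
have /(congr1 (fun k => k%:R : R)) := odd_ceil_countS m; rewrite natrD.
have := odd_divn_sum_approx R m N.*2; have := alt_sum_drop_floor R m N.*2.
have /andP[] := alt_harmonic_approx_ln2 R _ N0.
have fl : (m %/ N.*2.+1)%:R <= s.
  apply: le_trans ms; rewrite ler_pdivlMr ?ltr0n // -natrM ler_nat.
  exact: leq_trunc_div.
move: (\sum_(_ < _) _ / _) => S S0 S1.
have d0 : 0 <= m%:R * (ln 2 - S) by rewrite mulr_ge0.
have d1 : m%:R * (ln 2 - S) <= s by apply: le_trans ms; rewrite ler_wpM2l.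
have l2 : ln 2 <= 1 :> R by apply: (@le_ln1Dx R 1); lra.
have l0 : 0 <= ln 2 :> R by rewrite ln_ge0 // ler1n.
rewrite !ler_norml N2 mulrBr in d0 d1 *.
rewrite -(natr1 m) => /andP[A1 A2] /andP[B1 B2] C.
move: l0 l2 d0 d1 A1 A2 B1 B2 C fl s1 Ns {S0 S1}.
move: (ln _) (odd_ceil_count _)%:R (\sum_(k < m) _)%:R (m %/ _)%:R
  (\sum_(j < _) _) m%:R N%:R => *.
apply/andP; split; lra.
Qed.

Theorem corollary2p8 (R : realType) :
  ((fun n : nat => (odd_ceil_count n)%:R : R) =
     (fun n : nat => (1 - ln 2) * n%:R) +O_\oo (fun n : nat => Num.sqrt n%:R))
  /\ ((n%:R)^-1 * (odd_ceil_count n)%:R : R) @[n --> \oo] --> (1 - ln 2 : R).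
Proof.
split.
  apply/eqaddOP; near=> M; near=> n.
  apply: le_trans (odd_ceil_count_bound R n) _.
  rewrite [X in _ <= _ * X]ger0_norm ?sqrtr_ge0 // ler_wpM2r ?sqrtr_ge0 //.
apply/cvgrPdist_le => e e0; near=> n.
have n0 : 0 < n%:R :> R by rewrite ltr0n; near: n; exact: nbhs_infty_gt.
have -> : 1 - ln 2 - n%:R^-1 * (odd_ceil_count n)%:R
    = - (n%:R^-1 * ((odd_ceil_count n)%:R - (1 - ln 2) * n%:R)) :> R.
  by field; lra.
rewrite normrN normrM gtr0_norm ?invr_gt0 // mulrC ler_pdivrMr //.
apply: le_trans (odd_ceil_count_bound R n) _.
have s2 : Num.sqrt n%:R * Num.sqrt n%:R = n%:R :> R.
  by rewrite -expr2 sqr_sqrtr ?ler0n.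
(* Cancelling one factor sqrt n turns 5 sqrt n <= e n into 5 / e <= sqrt n, true once n >= (5 /
   e)^2. *)
rewrite -[in leRHS]s2 mulrA ler_wpM2r ?sqrtr_ge0 // mulrC -ler_pdivrMr //.
rewrite -[leLHS]ger0_norm ?divr_ge0 ?(ltW e0) // -sqrtr_sqr ler_wsqrtr //.
near: n; exact: nbhs_infty_ger.
Unshelve. all: by end_near. Qed.
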